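(* Let $\mathbf{k}$ be a field, $X=\{x_1,\dots,x_n\}$ with $n\ge2$, $f\in\mathrm{Sym}(X)$, let $(X,r_f)$ be the corresponding permutation idempotent solution, $\mathcal{A}=\mathcal{A}(\mathbf{k},X,r_f)$ its Yang-Baxter algebra, and $\mathcal{A}^+=\mathcal{A}_1\oplus\mathcal{A}_2\oplus\cdots$. (1) If $a,b\in\mathcal{A}$ are nonzero with $ab=0$, then $a,b\in\mathcal{A}^+$ and $a$ has a presentation $$a=\sum_{i=1}^n\alpha_{1i}x_i+\sum_{i=1}^n\alpha_{2i}x_1x_i+\cdots+\sum_{i=1}^n\alpha_{pi}x_1^{p-1}x_i,\qquad p\ge1,\ \alpha_{di}\in\mathbf{k}\ (1\le i\le n,\ 1\le d\le p),\qquad( * )$$ where $\sum_{i=1}^n\alpha_{di}=0$ for all $1\le d\le p$. (2) Conversely, if $a\in\mathcal{A}$ has a presentation $( * )$ with $\sum_{i=1}^n\alpha_{di}=0$ for all $1\le d\le p$, then $ab=0$ for all $b\in\mathcal{A}^+$.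
   Context: For $f\in\mathrm{Sym}(X)$ the permutation idempotent solution is $r_f(x,y)=(f(y),y)$ on $X\times X$, and its Yang-Baxter algebra is $\mathcal{A}(\mathbf{k},X,r_f)=\mathbf{k}\langle X\rangle/(xy-f(y)y\mid x,y\in X)$, where $\mathbf{k}\langle X\rangle$ is the free unital associative algebra on $X$; it is graded by word length, $\mathcal{A}=\bigoplus_{d\ge0}\mathcal{A}_d$ with $\mathcal{A}_0=\mathbf{k}$. *)

(* Defs.v *)
From HB Require Import structures.
From mathcomp Require Import all_boot all_order all_algebra all_fingroup.
From mathcomp Require Import generic_quotient ring_quotient.
From mathcomp Require Import finmap boolp.
From mathcomp.multinomials Require Import monalg.

Set Implicit Arguments.
Unset Strict Implicit.
Unset Printing Implicit Defensive.

Import GRing.Theory.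
Local Open Scope ring_scope.
Local Open Scope quotient_scope.

(* The free unital associative algebra k<X>: the monoid algebra of the free
   monoid on X. *)
Notation free_alg k X := {malg k[{fmonom X}]}.

Fact malg_scalerAr (K : monomType) (k : comNzRingType) (c : k)
    (p q : {malg k[K]}) : c *: (p * q) = p * (c *: q).
Proof.
apply/malgP => w.
rewrite mcoeffZ (mcoeffMlw _ (fsubset_refl _) (msuppZ_le c q)).
rewrite (mcoeffMlw _ (fsubset_refl _) (fsubset_refl _)).
rewrite mulr_sumr; apply: eq_bigr => u _.
rewrite mulr_sumr; apply: eq_bigr => v _.
by rewrite mcoeffZ mulrnAr mulrCA.
Qed.

HB.lock Definition free_var (k : fieldType) (X : choiceType) (x : X) :
  free_alg k X := << fmu x >>.
Canonical free_var_unlockable := Unlockable free_var.unlock.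

Definition free_homog (k : fieldType) (X : choiceType) (d : nat)
    (p : free_alg k X) : Prop :=
  forall w, w \in msupp p -> fdeg w = d.

Inductive two_sided_ideal (A : nzRingType) (G : A -> Prop) : A -> Prop :=
| TsiGen a of G a : two_sided_ideal G a
| Tsi0 : two_sided_ideal G 0
| TsiB a b of two_sided_ideal G a & two_sided_ideal G b :
    two_sided_ideal G (a - b)
| TsiMl a b of two_sided_ideal G b : two_sided_ideal G (a * b)
| TsiMr a b of two_sided_ideal G a : two_sided_ideal G (a * b).

Section YangBaxterAlgebra.
Variables (k : fieldType) (X : choiceType) (r : X * X -> X * X).

(* The defining relations xy = x'y', where r(x, y) = (x', y'). *)
Definition yb_relator (p : free_alg k X) : Prop :=
  exists x y : X,
    p = free_var k x * free_var k y
        - free_var k (r (x, y)).1 * free_var k (r (x, y)).2.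

Definition yb_ideal : {pred free_alg k X} :=
  fun p => `[< two_sided_ideal yb_relator p >].

Fact yb_idealP p : reflect (two_sided_ideal yb_relator p) (p \in yb_ideal).
Proof. exact: asboolP. Qed.

Fact yb_ideal_zmod_closed : zmod_closed yb_ideal.
Proof.
split=> [|p q /yb_idealP Ip /yb_idealP Iq]; apply/yb_idealP.
  exact: Tsi0.
exact: TsiB.
Qed.

HB.instance Definition _ :=
  GRing.isZmodClosed.Build (free_alg k X) yb_ideal yb_ideal_zmod_closed.

Fact yb_idealMl p q : q \in yb_ideal -> p * q \in yb_ideal.
Proof. by move=> /yb_idealP Iq; apply/yb_idealP/TsiMl. Qed.

Fact yb_idealMr p q : p \in yb_ideal -> p * q \in yb_ideal.
Proof. by move=> /yb_idealP Ip; apply/yb_idealP/TsiMr. Qed.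

Fact yb_idealZ c p : p \in yb_ideal -> c *: p \in yb_ideal.
Proof. by move=> Ip; rewrite -[p]mul1r scalerAl yb_idealMl. Qed.

Fact yb_ideal_const p : p \in yb_ideal -> p@_mone = 0.
Proof.
pose e : {rmorphism free_alg k X -> k} := @mcoeff _ k mone.
have ev x : e (free_var k x) = 0 by rewrite /e /= unlock mcoeffU -fdeg_eq0 fdegU.
have e_rel x y u v :
    e (free_var k x * free_var k y - free_var k u * free_var k v) = 0.
  move: (ev x) (ev u); move: (free_var k x) (free_var k u) => g h g0 h0.
  by rewrite (rmorphB e) (rmorphM e g) (rmorphM e h) g0 h0 !mul0r subrr.
move=> /yb_idealP; rewrite -[p@_mone]/(e p); move: e {ev} e_rel => e e_rel.
elim=> {p} [_ [x [y ->]]||p q _ p0 _ q0|p q _ q0|p q _ p0].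
- exact: e_rel.
- exact: (rmorph0 e).
- by rewrite (rmorphB e) p0 q0 subrr.
- by rewrite (rmorphM e) q0 mulr0.
- by rewrite (rmorphM e) p0 mul0r.
Qed.

(* The Yang-Baxter algebra A(k, X, r) = k<X> / (xy - x'y' | r(x,y) = (x',y')).
   The quotient as an additive group comes from ring_quotient, whose ring
   structure is restricted to commutative rings. *)
Definition yb_alg : Type := {ideal_quot yb_ideal}.

HB.instance Definition _ := Choice.on yb_alg.
HB.instance Definition _ := EqQuotient.on yb_alg.
HB.instance Definition _ := GRing.Zmodule.on yb_alg.

Definition yb_pi (p : free_alg k X) : yb_alg := \pi_{ideal_quot yb_ideal} p.

Definition yb_repr (a : yb_alg) : free_alg k X := repr a.

Fact yb_reprK : cancel yb_repr yb_pi.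
Proof. exact: reprK. Qed.

Fact yb_pi_eqP p q : reflect (yb_pi p = yb_pi q) (p - q \in yb_ideal).
Proof. by rewrite Quotient.idealrBE; apply: eqP. Qed.

Fact yb_pi_is_zmod_morphism : zmod_morphism yb_pi.
Proof. exact: (raddfB (\pi_{ideal_quot yb_ideal})). Qed.

HB.instance Definition _ :=
  GRing.isZmodMorphism.Build _ _ yb_pi yb_pi_is_zmod_morphism.

(* Locked: a failing unification would otherwise unfold the product of the
   monoid algebra. *)
Definition yb_mul : yb_alg -> yb_alg -> yb_alg :=
  locked (fun a b => yb_pi (yb_repr a * yb_repr b)).
Definition yb_scale : k -> yb_alg -> yb_alg :=
  locked (fun c a => yb_pi (c *: yb_repr a)).

Fact yb_repr_pi p : yb_repr (yb_pi p) - p \in yb_ideal.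
Proof. by apply/yb_pi_eqP; rewrite yb_reprK. Qed.

Fact yb_piM p q : yb_pi (p * q) = yb_mul (yb_pi p) (yb_pi q).
Proof.
rewrite /yb_mul -lock; apply/esym/yb_pi_eqP.
have /(yb_idealMr (yb_repr (yb_pi q))) Ip := yb_repr_pi p.
have /(yb_idealMl p) Iq := yb_repr_pi q.
by have := rpredD Ip Iq; rewrite mulrBl mulrBr addrA subrK.
Qed.

Fact yb_piZ c p : yb_pi (c *: p) = yb_scale c (yb_pi p).
Proof.
rewrite /yb_scale -lock; apply/esym/yb_pi_eqP.
by rewrite -scalerBr yb_idealZ // yb_repr_pi.
Qed.

Fact yb_mulA : associative yb_mul.
Proof.
move=> a b c; rewrite -[a]yb_reprK -[b]yb_reprK -[c]yb_reprK.
by rewrite -!yb_piM mulrA.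
Qed.

Fact yb_mul1r : left_id (yb_pi 1) yb_mul.
Proof. by move=> a; rewrite -[a]yb_reprK -yb_piM mul1r. Qed.

Fact yb_mulr1 : right_id (yb_pi 1) yb_mul.
Proof. by move=> a; rewrite -[a]yb_reprK -yb_piM mulr1. Qed.

Fact yb_mulDl : left_distributive yb_mul +%R.
Proof.
move=> a b c; rewrite -[a]yb_reprK -[b]yb_reprK -[c]yb_reprK.
by rewrite -raddfD -!yb_piM mulrDl raddfD.
Qed.

Fact yb_mulDr : right_distributive yb_mul +%R.
Proof.
move=> a b c; rewrite -[a]yb_reprK -[b]yb_reprK -[c]yb_reprK.
by rewrite -raddfD -!yb_piM mulrDr raddfD.
Qed.

Fact yb_oner_neq0 : yb_pi 1 != 0.
Proof.
apply/eqP; rewrite -(raddf0 yb_pi) => /yb_pi_eqP /yb_ideal_const /eqP.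
by rewrite subr0 mcoeffUU oner_eq0.
Qed.

HB.instance Definition _ := GRing.Zmodule_isNzRing.Build yb_alg
  yb_mulA yb_mul1r yb_mulr1 yb_mulDl yb_mulDr yb_oner_neq0.

Fact yb_pi_is_monoid_morphism : monoid_morphism yb_pi.
Proof. by split=> [|p q]; [|exact: yb_piM]. Qed.

HB.instance Definition _ :=
  GRing.isMonoidMorphism.Build _ _ yb_pi yb_pi_is_monoid_morphism.

Fact yb_scaleA c d a : yb_scale c (yb_scale d a) = yb_scale (c * d) a.
Proof. by rewrite -[a]yb_reprK -!yb_piZ scalerA. Qed.

Fact yb_scale1r : left_id 1 yb_scale.
Proof. by move=> a; rewrite -[a]yb_reprK -yb_piZ scale1r. Qed.

Fact yb_scaleDr : right_distributive yb_scale +%R.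
Proof.
move=> c a b; rewrite -[a]yb_reprK -[b]yb_reprK.
by rewrite -raddfD -!yb_piZ scalerDr raddfD.
Qed.

Fact yb_scaleDl a : {morph yb_scale^~ a : c d / c + d}.
Proof. by move=> c d; rewrite -[a]yb_reprK -!yb_piZ scalerDl raddfD. Qed.

HB.instance Definition _ := GRing.Zmodule_isLmodule.Build k yb_alg
  yb_scaleA yb_scale1r yb_scaleDr yb_scaleDl.

Fact yb_pi_is_scalable : scalable yb_pi.
Proof. by move=> c p; apply: yb_piZ. Qed.

HB.instance Definition _ :=
  GRing.isScalable.Build k (free_alg k X) yb_alg *:%R yb_pi yb_pi_is_scalable.

Fact yb_scalerAl (c : k) (a b : yb_alg) : c *: (a * b) = (c *: a) * b.
Proof.
rewrite -[a]yb_reprK -[b]yb_reprK -(rmorphM yb_pi) -!(linearZ_LR yb_pi) /=.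
by rewrite -(rmorphM yb_pi) /= scalerAl.
Qed.

HB.instance Definition _ := GRing.Lmodule_isLalgebra.Build k yb_alg yb_scalerAl.

Fact yb_scalerAr (c : k) (a b : yb_alg) : c *: (a * b) = a * (c *: b).
Proof.
rewrite -[a]yb_reprK -[b]yb_reprK -(rmorphM yb_pi) -!(linearZ_LR yb_pi) /=.
by rewrite -(rmorphM yb_pi) /= malg_scalerAr.
Qed.

HB.instance Definition _ := GRing.Lalgebra_isAlgebra.Build k yb_alg yb_scalerAr.

Definition yb_var (x : X) : yb_alg := yb_pi (free_var k x).

(* The graded component A_d. *)
Definition yb_homog (d : nat) (a : yb_alg) : Prop :=
  exists2 p : free_alg k X, free_homog d p & a = yb_pi p.

(* A^+, the sum of the A_d with d >= 1. *)
Definition yb_plus (a : yb_alg) : Prop :=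
  exists (m : nat) (c : nat -> yb_alg),
    (forall d, yb_homog d (c d)) /\ a = \sum_(1 <= d < m) c d.

End YangBaxterAlgebra.

Arguments yb_var k {X} r x.

(* The permutation idempotent solution r_f. *)
Definition perm_idem (X : finType) (f : {perm X}) (xy : X * X) : X * X :=
  (f xy.2, xy.2).

(* The right-hand side of the presentation: the sum of
   alpha_(d,i) x_1^(d-1) x_i over 1 <= d <= p and all i. The values alpha d
   with d = 0 or d > p play no role. *)
Definition presentation (k : fieldType) (A : algType k) (n p : nat)
    (x1 : A) (x : 'I_n -> A) (alpha : nat -> 'I_n -> k) : A :=
  \sum_(1 <= d < p.+1) \sum_(i < n) alpha d i *: (x1 ^+ d.-1 * x i).

(* Main.v *)
Require Import Defs.
From HB Require Import structures.
From mathcomp Require Import all_boot all_order all_algebra all_fingroup.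
From mathcomp Require Import ring.
From mathcomp Require Import finmap.
From mathcomp.multinomials Require Import monalg.

Set Implicit Arguments.
Unset Strict Implicit.
Unset Printing Implicit Defensive.

Import GRing.Theory.
Local Open Scope ring_scope.

(** The relations say exactly that x y = x' y for all generators x, x', y: both
    sides equal f(y) y.  So in a word every letter but the last may be replaced
    by x_1, and the elements 1 and x_1^(d-1) x_i span the algebra.  They are
    even a basis: for a fixed generator z, sending a generator y to t E, where E
    is one of two idempotent 2 x 2 matrices according to whether y = z, is a
    representation over k[t] ([perm_idem_band]), because the two idempotents
    satisfy E' E = E ([bandM]); its entries recover the constant term and the
    coefficients of the x_1^(d-1) z ([nf_eq0_band]).

    Write an element uniquely as a = c + sum_i q_i(x_1) x_i, with c in k and q_i
    in k[t], and put s_a = c + t sum_i q_i.  On the left of a generator, a acts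
    as the polynomial s_a(x_1) ([nfMgen]).  Hence, if
    b = d + sum_j r_j(x_1) x_j, then ab has constant term cd and j-th coefficient
    d q_j + s_a r_j ([nfM]).
    If ab = 0 while a and b are nonzero, working in the domain k[t] forces c, d
    and sum_i q_i to vanish ([nf_zero_divisors]); the coefficients of the
    polynomial sum_i q_i are the sums of the alpha_(d,i) over i.  Conversely,
    the vanishing of these sums means s_a = 0, so a kills every generator on its
    right, hence every word of positive length ([yb_plus_mul0]). *)

(** * Algebras in which x y depends only on y *)

Section NormalForms.
Variables (k : fieldType) (A : algType k) (n : nat) (x : 'I_n -> A) (o : 'I_n).
Hypothesis mulxx : forall i j, x i * x j = x o * x j.

Local Notation ev := (horner_alg (x o)).

(** The normal forms: in terms of words, the coefficient of t^d in [q i] is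
    that of x_o^d x_i. *)
Definition nf (c : k) (q : 'I_n -> {poly k}) : A :=
  c%:A + \sum_i ev (q i) * x i.

(** The polynomial in x_o by which [nf c q] acts on the left of the generators
    (see [nfMgen]). *)
Definition act (c : k) (q : 'I_n -> {poly k}) : {poly k} :=
  c%:P + 'X * \sum_i q i.

Lemma evZ e p : ev (e *: p) = e *: ev p.
Proof. by rewrite -mul_polyC rmorphM /= horner_algC mulr_algl. Qed.

Lemma ev_comm p : x o * ev p = ev p * x o.
Proof.
have /(congr1 ev) := mulrC 'X p.
by rewrite !rmorphM /= horner_algX.
Qed.

Lemma ev_rec p d : ev (p * 'X + d%:P) = x o * ev p + d%:A.
Proof. by rewrite rmorphD rmorphM /= horner_algX horner_algC ev_comm. Qed.

Lemma eq_nf c q r : q =1 r -> nf c q = nf c r.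
Proof.
by move=> qr; rewrite /nf; congr (_ + _); apply: eq_bigr => i _; rewrite qr.
Qed.

Lemma nf0 : nf 0 (fun=> 0) = 0.
Proof.
by rewrite /nf scale0r add0r big1 // => i _; rewrite rmorph0 mul0r.
Qed.

Lemma nfD c q d r : nf c q + nf d r = nf (c + d) (fun i => q i + r i).
Proof.
rewrite /nf scalerDl addrACA; congr (_ + _); rewrite -big_split /=.
by apply: eq_bigr => i _; rewrite rmorphD mulrDl.
Qed.

Lemma nfZ e c q : e *: nf c q = nf (e * c) (fun i => e *: q i).
Proof.
rewrite /nf scalerDr scalerA scaler_sumr; congr (_ + _).
by apply: eq_bigr => i _; rewrite evZ -scalerAl.
Qed.

Lemma nf1 : nf 1 (fun=> 0) = 1.
Proof.
by rewrite /nf scale1r big1 ?addr0 // => i _; rewrite rmorph0 mul0r.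
Qed.

Lemma nf_gen i : nf 0 (fun j => (j == i)%:R) = x i.
Proof.
rewrite /nf scale0r add0r (bigD1 i) //= eqxx rmorph1 mul1r big1 ?addr0 //.
by move=> j /negPf ->; rewrite rmorph0 mul0r.
Qed.

(** In x_i x_j the letter x_i may be traded for x_o, and powers of x_o commute
    with it. *)
Lemma nfMgen c q j : nf c q * x j = ev (act c q) * x j.
Proof.
rewrite /act rmorphD rmorphM /= horner_algC horner_algX rmorph_sum /=.
rewrite !mulrDl; congr (_ + _); rewrite mulr_suml mulr_sumr mulr_suml.
by apply: eq_bigr => i _; rewrite -[LHS]mulrA mulxx mulrA ev_comm.
Qed.

(** [ev p * x j] is a combination of words of positive length, each of which
    starts with a generator, to which [nfMgen] applies. *)
Lemma nfMterm c q p j :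
  nf c q * (ev p * x j) = ev (act c q) * (ev p * x j).
Proof.
elim/poly_ind: p => [|p d _]; first by rewrite rmorph0 mul0r !mulr0.
move: (nf c q) (ev (act c q)) (nfMgen c q) => u v uv.
rewrite ev_rec mulrDl !mulrDr.
by rewrite mulr_algl -!scalerAr uv !mulrA uv.
Qed.

Lemma nfM c q d r :
  nf c q * nf d r = nf (c * d) (fun j => d *: q j + act c q * r j).
Proof.
rewrite {2}/nf mulrDr -scalerAr mulr1 nfZ mulr_sumr.
under eq_bigr do rewrite nfMterm mulrA -rmorphM.
rewrite /nf mulrC -addrA; congr (_ + _); rewrite -big_split /=.
by apply: eq_bigr => i _; rewrite rmorphD /= [RHS]mulrDl.
Qed.

Lemma presentation_nf p alpha :
  presentation p (x o) x alpha = nf 0 (fun i => \poly_(d < p) alpha d.+1 i).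
Proof.
rewrite /presentation /nf scale0r add0r exchange_big /=.
apply: eq_bigr => i _.
rewrite big_add1 big_mkord poly_def rmorph_sum /= mulr_suml.
apply: eq_bigr => d _.
by rewrite evZ rmorphXn /= horner_algX scalerAl.
Qed.

Lemma nf_presentation p (q : 'I_n -> {poly k}) :
    (forall i, size (q i) <= p)%N ->
  nf 0 q = presentation p (x o) x (fun d i => (q i)`_d.-1).
Proof.
move=> le_qp; rewrite presentation_nf; apply: eq_nf => i.
apply/polyP => d; rewrite coef_poly; case: ltnP => // le_pd.
by rewrite nth_default // (leq_trans (le_qp i)).
Qed.

Lemma presentation_mul_gen p alpha j :
  (forall d, (1 <= d <= p)%N -> \sum_i alpha d i = 0) ->
  presentation p (x o) x alpha * x j = 0.
Proof.
move=> alpha0; rewrite presentation_nf nfMgen.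
suff -> : act 0 (fun i => \poly_(d < p) alpha d.+1 i) = 0.
  by rewrite rmorph0 mul0r.
rewrite /act polyC0 add0r (_ : \sum_i _ = 0) ?mulr0 //.
apply/polyP => d; rewrite coef_sum coef0; under eq_bigr do rewrite coef_poly.
by case: ltnP => lt_dp; [apply: alpha0 | rewrite big1].
Qed.

(** Two idempotent matrices E with E' E = E, the rows of which are (1, b) and
    (0, 0).  Multiplied by t, they give a model of the generators that tells one
    chosen generator from all the others. *)
Definition band (b : bool) : 'M[{poly k}]_2 :=
  delta_mx 0 0 + b%:R *: delta_mx 0 1.

Lemma bandM a b : band a * band b = band b.
Proof.
rewrite /band mulrDl !mulrDr -!scalerAl -!scalerAr.
rewrite -![delta_mx _ _ * _]/(_ *m _).
by rewrite !mul_delta_mx !mul_delta_mx_0 // !scaler0 !addr0.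
Qed.

(** Under such a representation, [nf c q] becomes the matrix with first row
    (c + t sum_j q_j, t q_i) and second row (0, c). *)
Lemma nf_eq0_band (h : {rmorphism A -> 'M[{poly k}]_2}) i c q :
    (forall d, h d%:A = d%:P%:M) ->
    (forall j, h (x j) = 'X *: band (j == i)) ->
  nf c q = 0 -> c = 0 /\ q i = 0.
Proof.
move=> hC hx /(congr1 h); rewrite rmorph0 /nf rmorphD hC rmorph_sum /=.
have hev p j : h (ev p * x j) = (p * 'X) *: band (j == i).
  elim/poly_ind: p => [|p d IHp].
    by rewrite rmorph0 !mul0r rmorph0 scale0r.
  rewrite ev_rec mulrDl -mulrA rmorphD /= (rmorphM h (x o)) /= IHp.
  rewrite (rmorphM h d%:A) /= hC !hx.
  rewrite -[d%:P%:M * _]/(d%:P%:M *m _) mul_scalar_mx -scalerAl -scalerAr bandM.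
  rewrite !scalerA -scalerDl; congr (_ *: _); ring.
under eq_bigr do rewrite hev.
move=> /matrixP hm; split.
  have:= hm 1 1; rewrite !mxE eqxx summxE big1 ?addr0 => [/eqP|j _].
    by rewrite mulr1n polyC_eq0 => /eqP.
  by rewrite !mxE /= mulr0 addr0 mulr0.
have:= hm 0 1; rewrite !mxE /= mulr0n add0r summxE (bigD1 i) //= big1 ?addr0.
  rewrite !mxE /= eqxx add0r !mulr1 => /eqP.
  by rewrite mulf_eq0 polyX_eq0 orbF => /eqP.
by move=> j /negPf nji; rewrite !mxE /= nji add0r mul0r mulr0.
Qed.

(** Linear independence of the words 1 and x_o^d x_i. *)
Hypothesis nf_eq0 : forall c q, nf c q = 0 -> c = 0 /\ forall i, q i = 0.

(** Let d be the constant term of the second factor.  If d = 0, some r_i is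
    nonzero and (act c q) r_i = 0, so act c q = 0; its value at 0 is c.  If d is
    nonzero, then c = 0, and summing the coefficients of the product gives
    (sum_i q_i) (d + t sum_i r_i) = 0; the second polynomial has the value d at
    0, so sum_i q_i = 0 and act c q = 0.  The coefficients of the product are
    then the d q_j, and the first factor would be zero. *)
Lemma nf_zero_divisors c q d r :
    nf c q != 0 -> nf d r != 0 -> nf c q * nf d r = 0 ->
  [/\ c = 0, d = 0 & \sum_i q i = 0].
Proof.
move=> a_neq0 b_neq0; rewrite nfM => /nf_eq0[cd0 qr0].
have sum0 : d *: (\sum_i q i) + act c q * \sum_i r i = 0.
  by rewrite scaler_sumr mulr_sumr -big_split /= big1 // => i _; apply: qr0.
have [d0|d_neq0] := eqVneq d 0.
  have [i ri_neq0] : exists i, r i != 0.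
    apply/existsP; apply: contraNT b_neq0 => /existsPn r0.
    by rewrite d0 (eq_nf _ (r := fun=> 0)) ?nf0 // => i; apply/eqP/negPn.
  have /eqP := qr0 i; rewrite d0 scale0r add0r mulf_eq0 (negPf ri_neq0) orbF.
  move=> /eqP act0; have c0 : c = 0.
    have /(congr1 (horner^~ 0)) := act0.
    by rewrite /act !hornerE.
  split=> //; move: act0; rewrite /act c0 polyC0 add0r => /eqP.
  by rewrite mulf_eq0 polyX_eq0 => /eqP.
have c0 : c = 0.
  by apply/eqP; move/eqP: cd0; rewrite mulf_eq0 (negPf d_neq0) orbF.
have : (\sum_i q i) * (d%:P + 'X * \sum_i r i) = 0.
  by rewrite -[RHS]sum0 /act c0 polyC0 -mul_polyC; ring.
move/eqP; rewrite mulf_eq0 => /orP[/eqP q0 | /eqP].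
  case/eqP: a_neq0; rewrite c0 (eq_nf _ (r := fun=> 0)) ?nf0 // => i.
  have := qr0 i; rewrite /act q0 mulr0 addr0 c0 mul0r addr0 => /eqP.
  by rewrite scaler_eq0 (negPf d_neq0) => /eqP.
move=> /(congr1 (horner^~ 0)); rewrite !hornerE => d0.
by rewrite d0 eqxx in d_neq0.
Qed.

End NormalForms.

(** * The Yang-Baxter algebra of a general solution *)

Section YangBaxter.
Variables (k : fieldType) (X : choiceType) (r : X * X -> X * X).

Local Notation A := (yb_alg k r).

Section Lift.
Variables (S : nzRingType) (g : {rmorphism free_alg k X -> S}).
Hypothesis g_rel : forall y z,
  g (free_var k y * free_var k z)
  = g (free_var k (r (y, z)).1 * free_var k (r (y, z)).2).

Lemma yb_ideal_ker p : p \in @yb_ideal k X r -> g p = 0.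
Proof.
move=> /yb_idealP; elim=> {p} [_ [y [z ->]]||p q _ p0 _ q0|p q _ q0|p q _ p0].
- by rewrite rmorphB /= g_rel subrr.
- exact: rmorph0.
- by rewrite rmorphB /= p0 q0 subrr.
- by rewrite rmorphM /= q0 mulr0.
- by rewrite rmorphM /= p0 mul0r.
Qed.

Definition yb_lift (a : A) : S := g (yb_repr a).

Lemma yb_lift_pi p : yb_lift (yb_pi r p) = g p.
Proof.
apply/eqP; rewrite -subr_eq0 -rmorphB; apply/eqP/yb_ideal_ker.
exact: yb_repr_pi.
Qed.

Fact yb_lift_is_zmod_morphism : zmod_morphism yb_lift.
Proof.
move=> a b; rewrite -[a]yb_reprK -[b]yb_reprK -raddfB !yb_lift_pi.
exact: rmorphB.
Qed.

Fact yb_lift_is_monoid_morphism : monoid_morphism yb_lift.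
Proof.
split=> [|a b].
  by rewrite -[1](rmorph1 (@yb_pi k X r)) yb_lift_pi rmorph1.
rewrite -[a]yb_reprK -[b]yb_reprK -[X in yb_lift X]rmorphM !yb_lift_pi.
exact: rmorphM.
Qed.

HB.instance Definition _ :=
  GRing.isZmodMorphism.Build A S yb_lift yb_lift_is_zmod_morphism.
HB.instance Definition _ :=
  GRing.isMonoidMorphism.Build A S yb_lift yb_lift_is_monoid_morphism.

(** Elements of the algebra are shown to differ by a representation that
    respects the relations; this replaces a confluence argument on words. *)
Lemma yb_alg_universal :
  exists h : {rmorphism A -> S}, forall p, h (yb_pi r p) = g p.
Proof. by exists yb_lift => p; apply: yb_lift_pi. Qed.

End Lift.

Definition word (s : seq X) : free_alg k X := << FMonom s >>.

Lemma word_nil : word [::] = 1.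
Proof. by rewrite /word -fmoneE. Qed.

Lemma word_cons y s : word (y :: s) = free_var k y * word s.
Proof.
rewrite /word unlock malgM_def fgmulUU mulr1; congr (<< _ >>).
by rewrite /mmul /= fmmulE fmuE.
Qed.

Lemma free_alg_words (p : free_alg k X) :
  p = \sum_(w <- msupp p) p@_w *: word w.
Proof.
rewrite [LHS]monalgE; apply: eq_bigr => w _; rewrite /word fmK.
by apply/malgP => v; rewrite mcoeffZ !mcoeffU mulr_natr.
Qed.

Lemma yb_alg_ind (P : A -> Prop) :
    P 0 -> P 1 ->
    (forall c a b, P a -> P b -> P (c *: a + b)) ->
    (forall y a, P a -> P (yb_var k r y * a)) ->
  forall a, P a.
Proof.
move=> P0 P1 PD PM a.
rewrite -[a]yb_reprK [yb_repr a]free_alg_words raddf_sum /=.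
elim/big_ind: _ => [//|b c Pb Pc|w _]; first by rewrite -[b]scale1r; apply: PD.
rewrite -[X in P X]addr0 (linearZ_LR (@yb_pi k X r)) /=; apply: PD => //.
elim: (w : seq X) => [|y s IHs]; first by rewrite word_nil rmorph1.
by rewrite word_cons rmorphM; apply: PM.
Qed.

(** A word of positive length starts with a generator. *)
Lemma yb_plus_mul0 (a b : A) :
  (forall y, a * yb_var k r y = 0) -> yb_plus b -> a * b = 0.
Proof.
move=> a0 [m [c [c_homog ->]]]; rewrite mulr_sumr big_nat.
apply: big1 => d /andP[d_gt0 _].
have [p p_homog ->] := c_homog d.
rewrite [p]free_alg_words raddf_sum /= mulr_sumr big_seq.
apply: big1 => w /p_homog.
rewrite (linearZ_LR (@yb_pi k X r)) /= -scalerAr fdegE.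
case: (w : seq X) => [|y s] dE; first by rewrite -dE in d_gt0.
by rewrite word_cons rmorphM mulrA a0 mul0r scaler0.
Qed.

Lemma yb_homog0 d : yb_homog d (0 : A).
Proof. by exists 0; rewrite ?raddf0 // => w; rewrite msupp0. Qed.

Lemma yb_homogD d (a b : A) :
  yb_homog d a -> yb_homog d b -> yb_homog d (a + b).
Proof.
move=> [p hp ->] [q hq ->]; exists (p + q); last by rewrite raddfD.
by move=> w /(fsubsetP (msuppD_le _ _)); rewrite in_fsetU => /orP[/hp|/hq].
Qed.

Lemma yb_homogZ d c (a : A) : yb_homog d a -> yb_homog d (c *: a).
Proof.
move=> [p hp ->]; exists (c *: p); last by rewrite (linearZ_LR (@yb_pi k X r)).
by move=> w /(fsubsetP (msuppZ_le _ _)) /hp.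
Qed.

Lemma yb_homogM d e (a b : A) :
  yb_homog d a -> yb_homog e b -> yb_homog (d + e) (a * b).
Proof.
move=> [p hp ->] [q hq ->]; exists (p * q); last by rewrite rmorphM.
by move=> w /msuppM_le [u [v [/hp <- /hq <- ->]]]; apply: fdegM.
Qed.

Lemma yb_homog_var y : yb_homog 1 (yb_var k r y).
Proof.
exists (free_var k y) => // w.
by rewrite unlock msuppU1 inE => /eqP ->; apply: fdegU.
Qed.

Lemma yb_homog1 : yb_homog 0 (1 : A).
Proof.
exists 1; last by rewrite rmorph1.
by move=> w; rewrite msuppU1 inE => /eqP ->; apply: fdeg1.
Qed.

Lemma yb_homogX d y : yb_homog d (yb_var k r y ^+ d).
Proof.
elim: d => [|d IHd]; first exact: yb_homog1.
by rewrite exprS -[d.+1]add1n; apply: yb_homogM => //; apply: yb_homog_var.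
Qed.

Lemma yb_plus_presentation n p (x : 'I_n -> X) (o : 'I_n) alpha :
  yb_plus (presentation p (yb_var k r (x o)) (fun i => yb_var k r (x i)) alpha).
Proof.
(* The degree 0 component has to be 0, whereas the summand of the presentation
   for d = 0 would have degree 1, since 0.-1 = 0. *)
pose c d : A := if d is e.+1 then
  \sum_(i < n) alpha d i *: (yb_var k r (x o) ^+ e * yb_var k r (x i)) else 0.
exists p.+1, c; split=> [[|d]|]; first exact: yb_homog0.
  apply: (big_ind (@yb_homog k X r d.+1)) => [|a b|i _];
    [exact: yb_homog0 | exact: yb_homogD |].
  apply: yb_homogZ; rewrite -[d.+1]addn1.
  by apply: yb_homogM; [exact: yb_homogX | exact: yb_homog_var].
by rewrite /presentation !big_add1.
Qed.

End YangBaxter.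

(** * Permutation idempotent solutions *)

Section PermIdem.
Variables (k : fieldType) (X : finType) (f : {perm X}).

Local Notation A := (yb_alg k (perm_idem f)).
Local Notation v := (yb_var k (perm_idem f)).

Lemma perm_idem_mul y y' z : v y * v z = v y' * v z.
Proof.
suff E u : v u * v z = v (f z) * v z by rewrite !E.
rewrite /yb_var -!rmorphM; apply/yb_pi_eqP/yb_idealP/TsiGen.
by exists u, z.
Qed.

Section Band.
Variable z : X.

Definition band_var (y : X) : 'M[{poly k}]_2 := 'X *: band k (y == z).

Definition band_word (w : {fmonom X}) : 'M[{poly k}]_2 :=
  \prod_(y <- (w : seq X)) band_var y.

Fact band_word_mmorphism : mmorphism band_word.
Proof.
by split=> [u w|]; rewrite /band_word ?fmM ?big_cat // fm1 big_nil.
Qed.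

HB.instance Definition _ :=
  isMultiplicative.Build _ _ band_word band_word_mmorphism.

Definition band_scal (c : k) : 'M[{poly k}]_2 := c%:P%:M.

HB.instance Definition _ := GRing.RMorphism.copy band_scal
  (@scalar_mx {poly k} 2 \o @polyC k).

Definition band_free (p : free_alg k X) : 'M[{poly k}]_2 :=
  mmap band_scal band_word p.

Fact band_free_is_zmod_morphism : zmod_morphism band_free.
Proof. exact: mmap_is_additive. Qed.

HB.instance Definition _ :=
  GRing.isZmodMorphism.Build _ _ band_free band_free_is_zmod_morphism.

Fact band_free_is_monoid_morphism : monoid_morphism band_free.
Proof.
have [] := @commr_mmap_is_multiplicative _ _ _ band_scal band_word.
  by move=> g m m'; apply/esym/comm_mx_scalar.
by [].
Qed.

HB.instance Definition _ :=
  GRing.isMonoidMorphism.Build _ _ band_free band_free_is_monoid_morphism.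

Lemma band_free_var y : band_free (free_var k y) = band_var y.
Proof.
by rewrite /band_free unlock mmapU /= rmorph1 mul1r /band_word fmU big_seq1.
Qed.

Lemma band_free_rel y t :
  band_free (free_var k y * free_var k t)
  = band_free (free_var k (perm_idem f (y, t)).1
               * free_var k (perm_idem f (y, t)).2).
Proof.
rewrite !rmorphM /= !band_free_var /band_var -!scalerAl -!scalerAr.
by rewrite !bandM.
Qed.

(** Both sides of a relation end in the same letter, and by [bandM] the value of
    a word of length two depends on its last letter only. *)
Lemma perm_idem_band : exists h : {rmorphism A -> 'M[{poly k}]_2},
  (forall c, h c%:A = c%:P%:M) /\ (forall y, h (v y) = 'X *: band k (y == z)).
Proof.
have [h hE] := yb_alg_universal band_free_rel.
exists h; split=> [c|y]; last by rewrite hE /= band_free_var.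
pose pi := @yb_pi k X (perm_idem f).
rewrite -[1](rmorph1 pi) -(linearZ_LR pi) hE.
by rewrite /= /band_free mmapZ mmap1 mulr1.
Qed.

End Band.

Variables (n : nat) (x : 'I_n -> X) (o : 'I_n).
Hypothesis x_bij : bijective x.

Local Notation vx := (fun i => v (x i)).

Lemma perm_idem_nf_eq0 c q : nf vx o c q = 0 -> c = 0 /\ forall i, q i = 0.
Proof.
move=> nf0; have nf_band i : c = 0 /\ q i = 0.
  have [h [hC hv]] := perm_idem_band (x i).
  have hx j : h (vx j) = 'X *: band k (j == i).
    by rewrite hv (inj_eq (bij_inj x_bij)).
  exact: nf_eq0_band hC hx nf0.
by split=> [|i]; [case: (nf_band o) | case: (nf_band i)].
Qed.

(** The normal forms contain the generators and are stable under linear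
    combinations and, by [nfM], under products. *)
Lemma perm_idem_nfP (a : A) : exists c q, a = nf vx o c q.
Proof.
have [x' _ x'K] := x_bij.
elim/yb_alg_ind: a => [||c _ _ [d [q ->]] [e [s ->]]|y _ [d [q ->]]].
- by exists 0, (fun=> 0); rewrite nf0.
- by exists 1, (fun=> 0); rewrite nf1.
- by rewrite nfZ nfD; eexists; eexists.
- rewrite -[y]x'K -[v _](nf_gen vx o) nfM; first by eexists; eexists.
  by move=> i j; apply: perm_idem_mul.
Qed.

End PermIdem.

(* x i is the generator x_(i+1); in particular x_1 has index 0. *)
Theorem theorem5p2 (k : fieldType) (n : nat) (n_ge2 : (2 <= n)%N)
    (X : finType) (x : 'I_n -> X) (x_bij : bijective x) (f : {perm X}) :
  let A : algType k := yb_alg k (perm_idem f) in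
  let X_ (i : 'I_n) : A := yb_var k (perm_idem f) (x i) in
  let X1 : A := X_ (Ordinal (ltnW n_ge2)) in
  (forall a b : A, a != 0 -> b != 0 -> a * b = 0 ->
     [/\ yb_plus a, yb_plus b &
         exists (p : nat) (alpha : nat -> 'I_n -> k),
           [/\ (1 <= p)%N,
               a = presentation p X1 X_ alpha &
               forall d : nat, (1 <= d <= p)%N -> \sum_(i < n) alpha d i = 0]])
  /\
  (forall (a : A) (p : nat) (alpha : nat -> 'I_n -> k),
     (1 <= p)%N ->
     a = presentation p X1 X_ alpha ->
     (forall d : nat, (1 <= d <= p)%N -> \sum_(i < n) alpha d i = 0) ->
     forall b : A, yb_plus b -> a * b = 0).
Proof.
move=> A X_ X1.
have mulXX i j : X_ i * X_ j = X1 * X_ j by apply: perm_idem_mul.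
split=> [a b a_neq0 b_neq0 ab0|a p alpha _ -> alpha0 b]; last first.
  have [x' _ x'K] := x_bij; apply: yb_plus_mul0 => y.
  by rewrite -[y]x'K; apply: (presentation_mul_gen mulXX).
have nf_pres q : exists2 p, (1 <= p)%N &
    nf X_ (Ordinal (ltnW n_ge2)) 0 q
    = presentation p X1 X_ (fun d i => (q i)`_d.-1).
  exists (\max_i size (q i)).+1 => //; apply: nf_presentation => i.
  by apply: leqW; apply: leq_bigmax.
have [c [q aE]] := perm_idem_nfP (Ordinal (ltnW n_ge2)) x_bij a.
have [d [s bE]] := perm_idem_nfP (Ordinal (ltnW n_ge2)) x_bij b.
have [c0 d0 q0] : [/\ c = 0, d = 0 & \sum_i q i = 0].
  rewrite aE bE in a_neq0 b_neq0 ab0.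
  have nf_eq0 := @perm_idem_nf_eq0 k _ f _ _ (Ordinal (ltnW n_ge2)) x_bij.
  exact: (nf_zero_divisors mulXX nf_eq0 a_neq0 b_neq0 ab0).
have [p p_gt0 pE] := nf_pres q; have [m _ mE] := nf_pres s.
rewrite c0 in aE; rewrite d0 in bE; split.
- by rewrite aE pE; apply: yb_plus_presentation.
- by rewrite bE mE; apply: yb_plus_presentation.
exists p, (fun d i => (q i)`_d.-1); split=> // [|e _]; first by rewrite aE.
by rewrite -coef_sum q0 coef0.
Qed.
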